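(* For all $n\ge1$ and $d\ge3$, $m_{d,n}=\left\lceil\frac{(d-1)(n-1)}{2}\right\rceil$, where $m_{d,n}$ is defined in the context.
   Context: $S_n$ is the set of permutations of $\{0,\dots,n-1\}$ in one-line notation. For $d\ge2$, $S^d_n$ is the set of $(d-1)$-tuples $\Pi=(\pi^2,\dots,\pi^d)$ of elements of $S_n$, with elements (columns) $\Pi_j=(\pi^2_j,\dots,\pi^d_j)^T$. The (sum) level is $\mathrm{lev}(\Pi_j)=\pi^2_j+\dots+\pi^d_j$, and $\mathrm{lev}_{\max}(\Pi)=\max_j\mathrm{lev}(\Pi_j)$. Define $m_{d,n}=\min\{\mathrm{lev}_{\max}(\Pi):\Pi\in S^d_n\}$. *)

(* Defs.v *)
From mathcomp Require Import all_boot all_fingroup.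

Set Implicit Arguments.
Unset Strict Implicit.
Unset Printing Implicit Defensive.

(* S^d_n. The entry pi^k of the source (2 <= k <= d) is [tnth Pi i] with
   k = i + 2; a permutation s : 'S_n of {0, ..., n-1} is read in one-line
   notation, its j-th letter being [s j]. *)
Definition dperm (d n : nat) : finType := (d.-1).-tuple 'S_n.

Definition column (d n : nat) (Pi : dperm d n) (j : 'I_n) : (d.-1).-tuple 'I_n :=
  [tuple tnth Pi i j | i < d.-1].

Definition lev (d n : nat) (c : (d.-1).-tuple 'I_n) : nat :=
  \sum_(i < d.-1) tnth c i.

Definition levmax (d n : nat) (Pi : dperm d n) : nat :=
  \max_(j < n) lev (column Pi j).

Definition id_dperm (d n : nat) : dperm d n := [tuple 1%g | i < d.-1].

(* [id_dperm] only witnesses that the set minimised over is nonempty. *)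
Definition minlevmax (d n : nat) : nat :=
  levmax [arg min_(Pi < id_dperm d n) levmax Pi].

Lemma minlevmax_attained (d n : nat) :
  exists Pi : dperm d n, levmax Pi = minlevmax d n.
Proof. by exists [arg min_(Pi < id_dperm d n) levmax Pi]. Qed.

Lemma minlevmax_le (d n : nat) (Pi : dperm d n) : minlevmax d n <= levmax Pi.
Proof. by rewrite /minlevmax; case: arg_minnP => // Pi0 _; apply. Qed.

(* Main.v *)
Require Import Defs.
From mathcomp Require Import all_boot all_fingroup.
From mathcomp Require Import zify.

(** Lower bound: the levels sum to (d-1)n(n-1)/2, so their maximum is at least
    their average (d-1)(n-1)/2.  Upper bound: a permutation and its reversal add
    up to the constant n-1, so pairs of this kind settle odd d, and leave only
    d = 4 for even d; there an explicit triple of permutations of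
    {0, ..., N} has all its column sums equal to N + floor(N/2) or
    N + ceil(N/2). *)

Lemma lev_column (d n : nat) (Pi : dperm d n) (j : 'I_n) :
  lev (column Pi j) = \sum_(p <- Pi) p j.
Proof. by rewrite /lev big_tuple; apply: eq_bigr => i _; rewrite tnth_mktuple. Qed.

Lemma sum_lev (d n : nat) (Pi : dperm d n) :
  \sum_(j < n) lev (column Pi j) = d.-1 * 'C(n, 2).
Proof.
rewrite (eq_bigr _ (fun j _ => lev_column _ _ Pi j)) exchange_big big_tuple /=.
rewrite -[X in X * _]card_ord -sum_nat_const; apply: eq_bigr => i _.
(* A permutation only reorders 0, ..., n-1, so each one contributes ['C(n, 2)]. *)
by rewrite -bin2_sum big_mkord [RHS](reindex_inj (@perm_inj _ (tnth Pi i))).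
Qed.

Lemma levmax_ge (d n : nat) (Pi : dperm d n) :
  0 < n -> uphalf (d.-1 * n.-1) <= levmax Pi.
Proof.
move=> n_gt0; rewrite leq_uphalf_double -(leq_pmul2l n_gt0).
have sum_le : \sum_(j < n) lev (column Pi j) <= n * levmax Pi.
  rewrite -[X in X * _]card_ord -sum_nat_const.
  by apply: leq_sum => j _; apply: leq_bigmax.
move: sum_le; rewrite sum_lev => sum_le.
have binE : n * n.-1 = 'C(n, 2).*2 by rewrite -mul2n -mul_bin_diag bin1.
by rewrite mulnCA binE -!doubleMr leq_double.
Qed.

Section Triple.

Variable N : nat.

(** Up to [N], even positions descend from [N] to [uphalf N], odd ones from [uphalf N - 1] to 0. *)
Definition triple2 (j : nat) : nat :=
  (if odd j then (uphalf N).-1 else N) - j./2.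

(** Even positions descend from [N./2] to 0, odd ones from [N] to [N./2 + 1]. *)
Definition triple3 (j : nat) : nat := (if odd j then N else N./2) - j./2.

(** The bound on [f] keeps [inord] from collapsing values to its default. *)
Lemma inord_inj (f : nat -> nat) :
    (forall j, j <= N -> f j <= N) ->
    (forall j k, j <= N -> k <= N -> f j = f k -> j = k) ->
  injective (fun j : 'I_N.+1 => inord (f j) : 'I_N.+1).
Proof.
move=> f_le f_inj j k /(congr1 val) /=.
rewrite !inordK ?ltnS ?f_le ?leq_ord //.
by move/(f_inj _ _ (leq_ord j) (leq_ord k))/val_inj.
Qed.

Lemma triple2_le j : j <= N -> triple2 j <= N.
Proof. by rewrite /triple2; case: ifP; lia. Qed.

Lemma triple3_le j : j <= N -> triple3 j <= N.
Proof. by rewrite /triple3; case: ifP; lia. Qed.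

Lemma triple2_inj j k : j <= N -> k <= N -> triple2 j = triple2 k -> j = k.
Proof. by rewrite /triple2; case: ifP; case: ifP; lia. Qed.

Lemma triple3_inj j k : j <= N -> k <= N -> triple3 j = triple3 k -> j = k.
Proof. by rewrite /triple3; case: ifP; case: ifP; lia. Qed.

Lemma triple_sum_le j :
  j <= N -> j + (triple2 j + triple3 j) <= uphalf (3 * N).
Proof. by rewrite /triple2 /triple3; case: ifP; lia. Qed.

Lemma perm_triple :
  exists2 s : seq 'S_N.+1, size s = 3 &
    forall j, \sum_(p <- s) p j <= uphalf (3 * N).
Proof.
exists [:: 1%g; perm (inord_inj _ triple2_le triple2_inj);
          perm (inord_inj _ triple3_le triple3_inj)] => // j.
have j_le : j <= N by rewrite -ltnS.
rewrite !big_cons big_nil perm1 !permE addn0.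
by rewrite !inordK ?ltnS ?triple2_le ?triple3_le ?triple_sum_le.
Qed.

(** Induction in steps of two from 0 and 3. A single permutation attains [N], which exceeds
    [uphalf N] once [N >= 2]. *)
Lemma perm_seq_sum_le (k : nat) :
  k != 1 -> exists2 s : seq 'S_N.+1, size s = k &
    forall j, \sum_(p <- s) p j <= uphalf (k * N).
Proof.
have [m] := ubnP k; elim: m k => // m IHm [|[|k]] // k_lt _.
  by exists [::] => // j; rewrite big_nil.
(* The length is now [k.+2], so [k = 1] is the case of the triple. *)
have [->|k_neq1] := eqVneq k 1; first exact: perm_triple.
have [|s size_s s_le] := IHm k _ k_neq1; first lia.
(* The added pair raises each column sum and the bound by exactly [N]. *)
exists [:: 1%g, perm (@rev_ord_inj N.+1) & s] => [|j]; first by rewrite /= size_s.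
rewrite !big_cons perm1 permE /= subSS.
by move: (s_le j) (ltn_ord j); rewrite !mulSn; lia.
Qed.

End Triple.

(* [uphalf k] is the ceiling of k / 2. *)
Theorem theorem4p1 (d n : nat) (hn : 1 <= n) (hd : 3 <= d) :
  minlevmax d n = uphalf ((d - 1) * (n - 1)).
Proof.
apply/eqP; rewrite !subn1 eqn_leq; apply/andP; split; last first.
  by have [Pi <-] := minlevmax_attained d n; apply: levmax_ge.
case: n hn => // N _.
have [|s size_s s_le] := @perm_seq_sum_le N d.-1; first lia.
have size_sb : size s == d.-1 by apply/eqP.
apply: leq_trans (@minlevmax_le d N.+1 (Tuple size_sb)) _.
apply/bigmax_leqP => j _; rewrite lev_column; exact: s_le.
Qed.
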